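(* Let $n$ be a positive integer and let $F(x)=x^{\frac{5^n-3}{2}}$ be a power function over $\mathbb{F}_{5^n}$. For $c=-1$, $F$ is AP$c$N, with $(-1)$-differential spectrum $$\mathbb S=\left\{{}_{-1}\omega_0=-\frac18\Gamma_{5,n}+\frac{3\cdot5^n-5}{8},\ {}_{-1}\omega_1=\frac14\Gamma_{5,n}+\frac{5^n+5}{4},\ {}_{-1}\omega_2=-\frac18\Gamma_{5,n}+\frac{3\cdot5^n-5}{8}\right\}$$ when $n$ is even, and with $(-1)$-differential spectrum $$\mathbb S=\left\{{}_{-1}\omega_0=-\frac18\Gamma_{5,n}+\frac{3\cdot5^n-13}{8},\ {}_{-1}\omega_1=\frac14\Gamma_{5,n}+\frac{5^n+13}{4},\ {}_{-1}\omega_2=-\frac18\Gamma_{5,n}+\frac{3\cdot5^n-13}{8}\right\}$$ when $n$ is odd, where $$\Gamma_{5,n}=(-1)^{n+1}\sum_{k=0}^{\lfloor n/2\rfloor}(-1)^k\binom{n}{2k}2^{2k+1}.$$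
   Context: For a function $F:\mathbb{F}_q\to\mathbb{F}_q$ and $a,b,c\in\mathbb{F}_q$, define ${}_c\delta_F(a,b)=\#\{x\in\mathbb{F}_q : F(x+a)-cF(x)=b\}$. The $c$-differential uniformity is ${}_c\Delta_F=\max\{{}_c\delta_F(a,b) : a,b\in\mathbb{F}_q,\ \text{and } a\neq 0 \text{ if } c=1\}$; $F$ is AP$c$N (almost perfect $c$-nonlinear) if ${}_c\Delta_F=2$. For a power function $F(x)=x^d$ put ${}_c\omega_i=\#\{b\in\mathbb{F}_q : {}_c\delta_F(1,b)=i\}$ for $0\le i\le {}_c\Delta_F$; the $c$-differential spectrum of $F$ is the multiset $\mathbb S=\{{}_c\omega_i : 0\le i\le {}_c\Delta_F \text{ and } {}_c\omega_i>0\}$, written by listing the values of the ${}_c\omega_i$. The integer $\Gamma_{5,n}$ is the character sum $\sum_{x\in\mathbb{F}_{5^n}}\chi(x(x-1)(x+1))$, with $\chi$ the quadratic character of $\mathbb{F}_{5^n}$ ($\chi(0)=0$); that this sum equals the displayed closed form is a known result from earlier literature.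
   Formalization: For n = 1, F(x) = x has (-1)-differential uniformity 1, so it is not APcN; APcN and the three-element spectrum are therefore claimed for n > 1 only, while for n = 1 the spectrum is {ω_1}; the formulas for ω_0, ω_1, ω_2 and Γ are proved for every n ≥ 1. *)

(* Defs.v *)
From mathcomp Require Import all_boot all_order all_algebra.
From mathcomp Require Import finmap multiset.

Set Implicit Arguments.
Unset Strict Implicit.
Unset Printing Implicit Defensive.

Import GRing.Theory.
Local Open Scope ring_scope.

Definition cdelta (K : finFieldType) (c : K) (F : K -> K) (a b : K) : nat :=
  #|[set x : K | F (x + a) - c * F x == b]|.

(* The maximum is over pairs p = (a, b). *)
Definition cuniformity (K : finFieldType) (c : K) (F : K -> K) : nat :=
  \max_(p : K * K | (c == 1) ==> (p.1 != 0)) cdelta c F p.1 p.2.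

Definition APcN (K : finFieldType) (c : K) (F : K -> K) : Prop :=
  cuniformity c F = 2%N.

(* Only a = 1 is inspected, so this is meant for power functions F. *)
Definition comega (K : finFieldType) (c : K) (F : K -> K) (i : nat) : nat :=
  #|[set b : K | cdelta c F 1 b == i]|.

Definition cspectrum (K : finFieldType) (c : K) (F : K -> K) : {mset nat}%mset :=
  seq_mset [seq w <- [seq comega c F i | i <- iota 0 (cuniformity c F).+1]
           | (0 < w)%N].

Definition quadchar (K : finFieldType) (x : K) : int :=
  if x == 0 then 0 else if [exists y : K, y ^+ 2 == x] then 1 else -1.

Definition Gamma (K : finFieldType) : int :=
  \sum_(x : K) quadchar (x * (x - 1) * (x + 1)).

(* Main.v *)
(* Write q = 5^n and chi for the quadratic character of K, so that
   F x = chi x / x. For b != 0, 1, -1 the number of solutions of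
   F (x + 1) + F x = b depends only on the signs chi (b - 1), chi b, chi (b + 1):
   solutions with chi (x + 1) = - chi x satisfy b = chi x / (x (x + 1)), those with
   chi (x + 1) = chi x satisfy b = chi x (2x + 1) / (x (x + 1)), and in
   characteristic 5 the relevant discriminants are perfect squares. This gives
   upper bounds for the fibers whose sum over b is q, hence exact values at most 2,
   and counting the b with prescribed signs reduces the spectrum to Gamma K.

   For Gamma K: Jacobsthal's second moment argument gives
   Gamma^2 + B^2 = 4q, so Gamma / 2 is up to sign the real or the imaginary part
   of (1 + 2i)^n unless 5 divides it. Euler's criterion gives
   Gamma = - (-2)^n mod 5, which selects the real part and the sign. *)

Require Import Defs.
From mathcomp Require Import all_boot all_order all_algebra finmap multiset.
From mathcomp Require Import fingroup cyclic finfield.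
From mathcomp Require Import ring lra zify.

Set Implicit Arguments.
Unset Strict Implicit.
Unset Printing Implicit Defensive.

Import GRing.Theory.
Local Open Scope ring_scope.

(** * The quadratic character *)

Section QuadraticCharacter.
Variables (K : finFieldType) (h : nat).
Hypothesis cardK : #|K| = h.*2.+1.
Local Notation chi := (@quadchar K).

Lemma half_card_gt0 : (0 < h)%N.
Proof. by have := finNzRing_gt1 K; rewrite cardK; case: h. Qed.

Lemma expf_double_half (x : K) : x != 0 -> x ^+ h.*2 = 1.
Proof.
move=> x0; apply: (mulfI x0); rewrite -exprS mulr1.
by rewrite -[RHS]expf_card cardK.
Qed.

(** The unit group is cyclic of order [h.*2]: if [x = g ^ k] and [x ^ h = 1], then [h.*2] divides
    [k * h], so [k] is even. *)
Lemma expf_half_eq1 (x : K) : x != 0 -> x ^+ h = 1 -> exists y, y ^+ 2 = x.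
Proof.
move=> x0 xh1.
have Ux : x \is a GRing.unit by rewrite unitfE.
pose u := FinRing.unit K Ux.
have /cyclicP[g Gg] := field_unit_group_cyclic [group of [set: {unit K}]].
have og : #[g]%g = h.*2.
  by rewrite orderE -Gg card_finField_unit cardK.
have : u \in <[g]>%g by rewrite -Gg inE.
case/cycleP=> k uk.
have : (u ^+ h = 1)%g by apply: val_inj; rewrite FinRing.val_unitX /= xh1.
rewrite uk -expgM => /eqP; rewrite -order_dvdn og -muln2 mulnC.
rewrite dvdn_pmul2r ?half_card_gt0 // => /dvdnP[j kj].
exists (val (g ^+ j)%g); rewrite -[RHS]/(val u) uk kj expgM.
by rewrite -FinRing.val_unitX.
Qed.

(** Otherwise the additive order of 1 would divide both 2 and the odd number [#|K|]. *)
Lemma two_neq0 : 2 != 0 :> K.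
Proof.
apply/eqP => two0.
have o2 : (#[1%R : K]%g %| 2)%N.
  by rewrite order_dvdn; apply/eqP; rewrite -[RHS]two0 expgS expg1.
have oK : (#[1%R : K]%g %| #|K|)%N by rewrite -cardsT order_dvdG ?inE.
have : (#[1%R : K]%g %| 1)%N.
  by rewrite -(dvdn_addr _ (dvdn_mulr h o2)) mul2n addn1 -cardK.
rewrite dvdn1 order_eq1 => /eqP; apply/eqP; exact: oner_neq0.
Qed.

Lemma one_neqN1 : 1 != -1 :> K.
Proof. by rewrite -subr_eq0 opprK; exact: two_neq0. Qed.

Lemma quadchar0 : chi 0 = 0.
Proof. by rewrite /quadchar eqxx. Qed.

Lemma quadchar_sqr (y : K) : y != 0 -> chi (y ^+ 2) = 1.
Proof.
move=> y0; rewrite /quadchar expf_eq0 (negPf y0) /=.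
by case: existsP => // -[]; exists y.
Qed.

Lemma quadchar_exp (x : K) : (chi x)%:~R = x ^+ h.
Proof.
rewrite /quadchar; have [->|x0] := eqVneq x 0.
  by rewrite expr0n eqn0Ngt half_card_gt0.
case: existsP => [[y /eqP yx]|nsq].
  rewrite -yx -exprM mul2n expf_double_half //.
  by apply: contra_neq x0 => y0; rewrite -yx y0 expr0n.
have /eqP := expf_double_half x0; rewrite -muln2 exprM sqrf_eq1.
case/orP => [/eqP xh|/eqP -> //].
by case: nsq; have [y <-] := expf_half_eq1 x0 xh; exists y.
Qed.

Variant quadchar_spec (x : K) : int -> Prop :=
  | QuadcharZero of x = 0 : quadchar_spec x 0
  | QuadcharSquare y of x = y ^+ 2 & y != 0 : quadchar_spec x 1
  | QuadcharNonsquare of x != 0 : quadchar_spec x (-1).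

Lemma quadcharP (x : K) : quadchar_spec x (chi x).
Proof.
rewrite /quadchar; have [->|x0] := eqVneq x 0; first by constructor.
case: existsP => [[y /eqP yx]|_]; last by constructor.
apply: (QuadcharSquare (y := y)) => //.
by apply: contra_neq x0 => y0; rewrite -yx y0 expr0n.
Qed.

(** Allows an identity between character values to be checked in [K], where Euler's criterion
    applies: 0, 1 and -1 stay distinct there because 2 is nonzero. *)
Lemma quadchar_inj (a b : K) (e1 e2 : int) :
  quadchar_spec a e1 -> quadchar_spec b e2 -> e1%:~R = e2%:~R :> K -> e1 = e2.
Proof.
have n1 := one_neqN1; have o0 := oner_neq0 K.
by case=> [_|? _ _|_] [_|? _ _|_] // /eqP;
  rewrite ?mulr0z ?mulr1z ?mulrN1z ?oppr_eq0 ?[0 == _]eq_sym ?oppr_eq0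
    ?[- 1 == _]eq_sym ?(negPf o0) ?(negPf n1).
Qed.

Lemma quadcharM (x y : K) : chi (x * y) = chi x * chi y.
Proof.
have [->|x0] := eqVneq x 0; first by rewrite mul0r quadchar0 mul0r.
have E : (chi (x * y))%:~R = (chi x * chi y)%:~R :> K.
  by rewrite intrM !quadchar_exp exprMn.
(* The witness [b] only certifies that the product is again 0, 1 or -1. *)
have [b Hb] : exists b : K, quadchar_spec b (chi x * chi y).
  case: (quadcharP x) => [x_eq0|z _ _|_]; first by rewrite x_eq0 eqxx in x0.
    by exists y; rewrite mul1r; apply: quadcharP.
  case: (quadcharP y) => [_|w _ w0|y0].
  - by exists 0; rewrite mulr0; constructor.
  - by exists x; rewrite mulr1; constructor.
  - exists 1; rewrite mulrNN mulr1; apply: (@QuadcharSquare 1 1).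
      by rewrite expr1n.
    exact: oner_neq0.
exact: quadchar_inj (quadcharP (x * y)) Hb E.
Qed.

Lemma quadchar1 : chi 1 = 1.
Proof. by rewrite -(expr1n _ 2) quadchar_sqr ?oner_neq0. Qed.

Lemma quadchar_mulsqr (x y : K) : y != 0 -> chi (y ^+ 2 * x) = chi x.
Proof. by move=> y0; rewrite quadcharM quadchar_sqr ?mul1r. Qed.

Lemma quadchar_eq0 (x : K) : (chi x == 0) = (x == 0).
Proof.
case: (quadcharP x) => [->|y -> y0|x0]; first by rewrite !eqxx.
  by rewrite expf_eq0 (negPf y0).
by rewrite (negPf x0).
Qed.

Lemma quadcharV (x : K) : chi x^-1 = chi x.
Proof.
have [->|x0] := eqVneq x 0; first by rewrite invr0.
have -> : x^-1 = x^-1 ^+ 2 * x by field.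
by rewrite quadchar_mulsqr ?invr_eq0.
Qed.

Lemma quadchar_sqrE (x : K) : x != 0 -> chi x * chi x = 1.
Proof. by move=> x0; rewrite -quadcharM -expr2 quadchar_sqr. Qed.

Lemma quadchar_sign (x : K) : x != 0 -> chi x = 1 \/ chi x = -1.
Proof.
by case: (quadcharP x) => [->|y|]; [rewrite eqxx|left|right].
Qed.

(** ['X^r - 1] has at most [r] roots, fewer than the [h.*2] nonzero elements. *)
Lemma expf_neq1_exists (r : nat) :
  (0 < r < h.*2)%N -> exists2 x : K, x != 0 & x ^+ r != 1.
Proof.
case/andP=> r0 rh.
have [x /andP[x0 xr]|noA] := pickP [pred x : K | (x != 0) && (x ^+ r != 1)].
  by exists x.
pose p : {poly K} := 'X^r - 1.
have p0 : p != 0 by rewrite -size_poly_eq0 size_XnsubC.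
have := @max_poly_roots _ p (enum [pred x : K | x != 0]) p0.
rewrite size_XnsubC // enum_uniq -cardE.
have -> : #|[pred x : K | x != 0]| = h.*2.
  by have := cardC1 (0 : K); rewrite cardK.
have -> : all (root p) (enum [pred x : K | x != 0]).
  apply/allP => x; rewrite mem_enum inE => x0.
  by have := noA x; rewrite /= x0 rootE !hornerE subr_eq0 => /negbFE.
by move/(_ isT isT); lia.
Qed.

Lemma nonsquare_exists : exists g : K, chi g = -1.
Proof.
have h0 := half_card_gt0.
have [|x x0 xh] := @expf_neq1_exists h; first by lia.
exists x; case: (quadchar_sign x0) => // x1.
by rewrite -quadchar_exp x1 eqxx in xh.
Qed.

Lemma sum_expf (e : nat) : (0 < e)%N ->
  \sum_(x : K) x ^+ e = if (h.*2 %| e)%N then -1 else 0.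
Proof.
move=> e0; have [/dvdnP[k ek]|ne] := boolP (h.*2 %| e)%N.
  rewrite (bigD1 0) //= expr0n eqn0Ngt e0 add0r.
  rewrite (eq_bigr (fun=> 1)) => [|x x0].
    rewrite sumr_const; have := cardC1 (0 : K); rewrite cardK /= => ->.
    apply/eqP; rewrite -addr_eq0 natr1 -cardK.
    have := expg_cardG (in_setT (1 : K)); rewrite FinRing.zmodXgE cardsT => ->.
    by [].
  by rewrite ek mulnC exprM expf_double_half // expr1n.
have [|g g0 gr] := @expf_neq1_exists (e %% h.*2).
  by rewrite lt0n -/(dvdn _ _) ne ltn_pmod // double_gt0 half_card_gt0.
have ge : g ^+ e != 1.
  by rewrite (divn_eq e h.*2) exprD mulnC exprM expf_double_half // expr1n mul1r.
(* Substituting [g * x] for [x] multiplies the power sum by [g ^ e], which is not 1. *)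
apply/eqP; have : (1 - g ^+ e) * \sum_(x : K) x ^+ e == 0.
  rewrite mulrBl mul1r mulr_sumr subr_eq0 {1}(reindex_inj (mulfI g0)) /=.
  by apply/eqP; apply: eq_bigr => x _; rewrite exprMn.
by rewrite mulf_eq0 subr_eq0 eq_sym (negPf ge).
Qed.

(** * Sums of the quadratic character *)

Lemma sum_quadchar : \sum_(x : K) chi x = 0.
Proof.
have [g gN] := nonsquare_exists.
have g0 : g != 0 by rewrite -quadchar_eq0 gN.
have : \sum_(x : K) chi x = - \sum_(x : K) chi x.
  rewrite {1}(reindex_inj (mulfI g0)) /= -sumrN.
  by apply: eq_bigr => x _; rewrite quadcharM gN mulN1r.
by move: (\sum_x _) => S; lia.
Qed.

Lemma sum_quadchar_shift (a : K) : \sum_(x : K) chi (x + a) = 0.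
Proof. by rewrite -[RHS]sum_quadchar [RHS](reindex_inj (addIr a)). Qed.

Lemma sum_quadchar_pair (a b : K) :
  a != b -> \sum_(x : K) chi (x + a) * chi (x + b) = -1.
Proof.
move=> ab; set c := b - a.
have c0 : c != 0 by rewrite subr_eq0 eq_sym.
have -> : \sum_(x : K) chi (x + a) * chi (x + b) = \sum_(x : K) chi (x * (x + c)).
  rewrite [RHS](reindex_inj (addIr a)) /=; apply: eq_bigr => x _.
  by rewrite quadcharM; congr (_ * chi _); rewrite /c; ring.
rewrite (bigD1 0) //= mul0r quadchar0 add0r.
(* For [x != 0], [x * (x + c)] is a square times [1 + c / x]. As [0^-1 = 0], the map [1 + c / x]
   permutes all of [K], and the excluded point [x = 0] accounts for [chi 1 = 1]. *)
have phiI : injective (fun x : K => 1 + c / x).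
  by move=> x y /addrI /(mulfI c0) /invr_inj.
have E : \sum_(x : K) chi (1 + c / x) = 0.
  by rewrite -[RHS]sum_quadchar [RHS](reindex_inj phiI).
move: E; rewrite (bigD1 0) //= invr0 mulr0 addr0 quadchar1 => E.
have -> : -1 = \sum_(i : K | i != 0) chi (1 + c / i).
  by apply/esym/eqP; rewrite -addr_eq0 addrC E.
apply: eq_bigr => x x0; rewrite -[RHS](quadchar_mulsqr _ x0); congr chi; field.
exact: x0.
Qed.

End QuadraticCharacter.

(** * Jacobsthal sums *)

Section Jacobsthal.
Variables (K : finFieldType) (h : nat).
Hypothesis cardK : #|K| = h.*2.+1.
Local Notation chi := (@quadchar K).
Hypothesis chiN1 : chi (-1) = 1.

Definition jacobsthal (k : K) : int := \sum_(x : K) chi (x ^+ 3 + k * x).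

Lemma quadcharN (x : K) : chi (- x) = chi x.
Proof. by rewrite -mulN1r (quadcharM cardK) chiN1 mul1r. Qed.

Lemma jacobsthal0 : jacobsthal 0 = 0.
Proof.
rewrite /jacobsthal -[RHS](sum_quadchar cardK); apply: eq_bigr => x _.
rewrite mul0r addr0; have [->|x0] := eqVneq x 0; first by rewrite expr0n.
by rewrite exprSr (quadchar_mulsqr cardK).
Qed.

Lemma jacobsthal_scale (k t : K) :
  t != 0 -> jacobsthal (k * t ^+ 2) = chi t * jacobsthal k.
Proof.
move=> t0; rewrite /jacobsthal (reindex_inj (mulfI t0)) /= mulr_sumr.
apply: eq_bigr => x _.
have -> : (t * x) ^+ 3 + k * t ^+ 2 * (t * x) = t ^+ 2 * (t * (x ^+ 3 + k * x)).
  by ring.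
by rewrite (quadchar_mulsqr cardK) // (quadcharM cardK).
Qed.

Lemma sum_quadchar_sqr (a : K) :
  \sum_(k : K) chi (k + a) * chi (k + a) = h.*2%:Z.
Proof.
have -> : \sum_(k : K) chi (k + a) * chi (k + a) = \sum_(k : K) chi k * chi k.
  by rewrite [RHS](reindex_inj (addIr a)).
rewrite (bigD1 0) //= quadchar0 mul0r add0r.
rewrite (eq_bigr (fun=> 1)) => [|x x0]; last by rewrite (quadchar_sqrE cardK).
rewrite sumr_const; have := cardC1 (0 : K); rewrite cardK /= => E.
by rewrite -[RHS]natz -E.
Qed.

Lemma sum_same_sqr (x : K) :
  \sum_(y | x ^+ 2 == y ^+ 2) chi y = 2 * chi x.
Proof.
have [->|x0] := eqVneq x 0.
  rewrite quadchar0 mulr0 big1 // => y; rewrite expr0n eq_sym expf_eq0 /=.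
  by move/eqP ->; rewrite quadchar0.
rewrite (bigD1 x) //= (bigD1 (- x)) /=; last first.
  rewrite sqrrN eqxx /= eq_sym -subr_eq0 opprK -mulr2n -mulr_natl.
  by rewrite mulf_neq0 // (two_neq0 cardK).
rewrite big1 => [|y]; first by rewrite quadcharN; ring.
by rewrite eqf_sqr => /andP[/andP[/orP[/eqP ->|/eqP ->]]]; rewrite ?opprK eqxx.
Qed.

(** Since [x ^ 3 + k * x = x * (k + x ^ 2)], summing over [k] first leaves pair sums equal to -1
    unless [x ^ 2 = y ^ 2]. The -1 part dies with the sum of [chi], so only [y = x] and [y = - x]
    contribute. *)
Lemma sum_jacobsthal_sqr :
  \sum_(k : K) jacobsthal k ^+ 2 = 2 * h.*2.+1%:Z * h.*2%:Z.
Proof.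
have E k : jacobsthal k ^+ 2 = \sum_x \sum_y
    chi x * chi y * (chi (k + x ^+ 2) * chi (k + y ^+ 2)).
  rewrite expr2 /jacobsthal big_distrlr /=; apply: eq_bigr => x _.
  apply: eq_bigr => y _.
  have Q z : z ^+ 3 + k * z = z * (k + z ^+ 2) by ring.
  by rewrite !Q !(quadcharM cardK); ring.
under eq_bigr do rewrite E.
rewrite exchange_big /=; under eq_bigr do rewrite exchange_big /=.
under eq_bigr do under eq_bigr do rewrite -mulr_sumr.
have I x y : \sum_k chi (k + x ^+ 2) * chi (k + y ^+ 2)
    = (if x ^+ 2 == y ^+ 2 then h.*2.+1%:Z else 0) - 1.
  have [->|ne] := eqVneq (x ^+ 2) (y ^+ 2); last by rewrite (sum_quadchar_pair cardK).
  by rewrite sum_quadchar_sqr; lia.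
under eq_bigr do under eq_bigr do rewrite I mulrBr mulr1.
under eq_bigr do rewrite sumrB -mulr_sumr (sum_quadchar cardK) mulr0 subr0.
under eq_bigr => x _.
  rewrite (eq_bigr (fun y => if x ^+ 2 == y ^+ 2
     then chi x * h.*2.+1%:Z * chi y else 0)); last first.
    by move=> y _; case: ifP => _; rewrite ?mulr0 //; ring.
  rewrite -big_mkcond /= -mulr_sumr sum_same_sqr.
  have -> : chi x * h.*2.+1%:Z * (2 * chi x)
    = 2 * h.*2.+1%:Z * (chi (x + 0) * chi (x + 0)) by rewrite addr0; ring.
  over.
by rewrite -mulr_sumr sum_quadchar_sqr.
Qed.

(* For k != 0 the value of (jacobsthal k)^2 only depends on chi k, so the second
   moment above determines the sum of the two possible values. *)
Lemma jacobsthal_two_squares (g : K) : chi g = -1 ->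
  jacobsthal (-1) ^+ 2 + jacobsthal g ^+ 2 = 4 * h.*2.+1%:Z.
Proof.
move=> gN.
have g0 : g != 0 by rewrite -quadchar_eq0 gN.
have SqE (k t : K) : t != 0 -> jacobsthal (k * t ^+ 2) ^+ 2 = jacobsthal k ^+ 2.
  move=> t0; rewrite jacobsthal_scale // exprMn.
  by rewrite [X in X * _]expr2 (quadchar_sqrE cardK) // mul1r.
(* Writing the two possible values as an affine function of [chi k] lets [sum_quadchar] evaluate the
   sum over [k]. *)
have E (k : K) : k != 0 -> 2 * jacobsthal k ^+ 2
   = (1 + chi k) * jacobsthal (-1) ^+ 2 + (1 - chi k) * jacobsthal g ^+ 2.
  move=> k0; case: (quadchar_sign k0) => ck; rewrite ck.
    have : chi (- k) = 1 by rewrite quadcharN.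
    case: (quadcharP (- k)) => // t kt t0 _.
    by have -> : k = -1 * t ^+ 2; [rewrite -kt; ring | rewrite SqE //; ring].
  have : chi (k / g) = 1 by rewrite (quadcharM cardK) (quadcharV cardK) gN ck.
  case: (quadcharP (k / g)) => // t kt t0 _.
  by have -> : k = g * t ^+ 2; [rewrite -kt; field | rewrite SqE //; ring].
have h0 := half_card_gt0 cardK.
apply: (@mulfI _ h.*2%:Z); first by lia.
have -> : h.*2%:Z * (4 * h.*2.+1%:Z) = 2 * (2 * h.*2.+1%:Z * h.*2%:Z) by ring.
rewrite -sum_jacobsthal_sqr mulr_sumr (bigD1 0) //= jacobsthal0 expr0n mulr0 add0r.
under eq_bigr => k k0 do rewrite E //.
set A := _ ^+ 2; set B := jacobsthal g ^+ 2.
rewrite (eq_bigr (fun k => (A + B) + chi k * (A - B))); last by move=> k _; ring.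
rewrite big_split /= -mulr_suml sumr_const.
have := sum_quadchar cardK; rewrite (bigD1 0) //= quadchar0 add0r => ->.
have := cardC1 (0 : K); rewrite cardK /= => ->.
by rewrite mul0r addr0 -mulr_natl natz.
Qed.

End Jacobsthal.

(** * Powers of 1 + 2i *)

(* The real and imaginary parts of (1 + 2i)^n. *)
Fixpoint gauss_pow (n : nat) : int * int :=
  if n is m.+1 then
    let p := gauss_pow m in (p.1 - 2 * p.2, 2 * p.1 + p.2)
  else (1, 0).

Lemma gauss_powS n : gauss_pow n.+1 =
  ((gauss_pow n).1 - 2 * (gauss_pow n).2, 2 * (gauss_pow n).1 + (gauss_pow n).2).
Proof. by []. Qed.

(** Pascal's rule. The cutoff [N] is independent of [n], so both sums keep the same range through
    the induction; binomials beyond [n] vanish. *)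
Lemma gauss_pow_binomial n N : (n < N.*2)%N ->
  (gauss_pow n).1 =
    \sum_(0 <= k < N) (-1) ^+ k * ('C(n, 2 * k) * 2 ^ (2 * k))%:R
  /\ (gauss_pow n).2 =
       \sum_(0 <= k < N) (-1) ^+ k * ('C(n, (2 * k).+1) * 2 ^ (2 * k).+1)%:R.
Proof.
elim: n => [|n IHn] ltnN.
  case: N ltnN => // N _; split.
    rewrite big_nat_recl //= big1 ?addr0 // => i _.
    by rewrite bin0n; case: i => [//|i]; rewrite mulr0.
  by rewrite big1 //= => i _; rewrite bin0n mulr0.
have {IHn}[|/= -> ->] := IHn; first exact: ltnW.
case: N ltnN => // N ltnN; split.
  rewrite [X in _ - 2 * X]big_nat_recr // [X in _ - 2 * (_ + X)]/=.
  rewrite (@bin_small n (2 * N).+1); last by lia.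
  rewrite mul0n mulr0 addr0 !(big_nat_recl N) //= mulr_sumr -addrA -sumrB.
  rewrite !bin0; congr (_ + _); apply: eq_bigr => k _.
  have -> : (2 * k.+1 = (2 * k).+2)%N by lia.
  by rewrite binS mulnDl [(2 ^ (2 * k).+2)%N]expnS !natrM !natrD !natrM exprS; ring.
rewrite mulr_sumr -big_split; apply: eq_bigr => k _ /=.
by rewrite binS mulnDl [(2 ^ (2 * k).+1)%N]expnS !natrM !natrD !natrM; ring.
Qed.

(** As -1 is the square of 2 modulo 5, the sum of squares is congruent to
    [(b - 2 * a) * (b + 2 * a)]. *)
Lemma sum_sqr_mod5 (a b m : int) : a ^+ 2 + b ^+ 2 = 5 * m ->
  exists c, b = 2 * a + 5 * c \/ b = - (2 * a + 5 * c).
Proof.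
rewrite (divz_eq a 5) (divz_eq b 5).
have := ltz_pmod a (isT : 0 < 5 :> int); have := modz_ge0 a (isT : 5 != 0 :> int).
have := ltz_pmod b (isT : 0 < 5 :> int); have := modz_ge0 b (isT : 5 != 0 :> int).
move: (a %% 5)%Z (a %/ 5)%Z (b %% 5)%Z (b %/ 5)%Z => r k s l s0 s5 r0 r5 E.
have /orP[/eqP H|/eqP H] : (s == 2 * r %[mod 5])%Z || (s == - (2 * r) %[mod 5])%Z.
  have : r \in [:: 0; 1; 2; 3; 4] by rewrite !inE; lia.
  have : s \in [:: 0; 1; 2; 3; 4] by rewrite !inE; lia.
  rewrite !inE => /or4P[/eqP|/eqP|/eqP|/orP[] /eqP] ?
    /or4P[/eqP|/eqP|/eqP|/orP[] /eqP] ?;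
    subst r s; rewrite //; exfalso; move: E; clear; nia.
- by exists (l - 2 * k + ((s - 2 * r) %/ 5)%Z); left; lia.
- by exists (- l - 2 * k - ((s + 2 * r) %/ 5)%Z); right; lia.
Qed.

Lemma sum_sqr_mod4 (a b m : int) : a ^+ 2 + b ^+ 2 = 4 * m ->
  exists c d, a = 2 * c /\ b = 2 * d.
Proof.
rewrite (divz_eq a 2) (divz_eq b 2).
have := ltz_pmod a (isT : 0 < 2 :> int); have := modz_ge0 a (isT : 2 != 0 :> int).
have := ltz_pmod b (isT : 0 < 2 :> int); have := modz_ge0 b (isT : 2 != 0 :> int).
move: (a %% 2)%Z (a %/ 2)%Z (b %% 2)%Z (b %/ 2)%Z => r k s l s0 s2 r0 r2 E.
exists k, l.
have : r \in [:: 0; 1] by rewrite !inE; lia.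
have : s \in [:: 0; 1] by rewrite !inE; lia.
rewrite !inE => /orP[] /eqP ? /orP[] /eqP ?; subst r s; first by lia.
all: exfalso; move: E; clear; nia.
Qed.

(* Up to units and conjugation (1 + 2i)^n is the only Gaussian integer of norm
   5^n not divisible by 5: after conjugating, a + bi is divisible by 1 + 2i. *)
Lemma gauss_pow_unique n (a b : int) : a ^+ 2 + b ^+ 2 = 5 ^+ n ->
  (forall x y : int, ~ (a = 5 * x /\ b = 5 * y)) ->
  let: (c, d) := gauss_pow n in
  (a = c \/ a = - c) /\ (b = d \/ b = - d) \/
  (a = d \/ a = - d) /\ (b = c \/ b = - c).
Proof.
elim: n a b => [|n IHn] a b.
  rewrite expr0 => E _ /=.
  have : -1 <= a <= 1 by nia.
  have : -1 <= b <= 1 by nia.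
  by nia.
rewrite [5 ^+ _]exprS => E nd; have [c bE] := sum_sqr_mod5 E.
(* Changing the sign of [b] is conjugation. *)
wlog {bE}bE : b E nd / b = 2 * a + 5 * c => [H|].
  case: bE => bE; first exact: H.
  have := H (- b); rewrite sqrrN => /(_ E) /=.
  have -> : - b = 2 * a + 5 * c by lia.
  have nd' (x y : int) : ~ (a = 5 * x /\ 2 * a + 5 * c = 5 * y).
    by move=> [ax by_]; apply: (nd x (- y)); lia.
  by move/(_ nd' erefl); lia.
(* [a' + b' i] is the quotient of [a + b i] by [1 + 2i]. *)
pose a' := a + 2 * c; pose b' := c.
have E' : a' ^+ 2 + b' ^+ 2 = 5 ^+ n.
  by move: E; rewrite /a' /b' bE; move: (5 ^+ n) => m; nia.
have nd' (x y : int) : ~ (a' = 5 * x /\ b' = 5 * y).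
  by rewrite /a' /b' => -[ax cy]; apply: (nd (x - 2 * y) (2 * x + y)); lia.
have /= := IHn a' b' E' nd'.
(* In four of the eight sign patterns the quotient is an associate of the conjugate power;
   multiplying by [1 + 2i] then gives a multiple of 5, against [nd]. The witnesses are the
   coordinates of the conjugate of the next lower power, up to units. *)
rewrite /a' /b'; case: n {IHn E E' a' b' nd'} => [|n] /=; first by lia.
case: (gauss_pow n) => e f /= [] [[] Ea [] Ec].
- by left; split; [left|left]; lia.
- by case: (nd e (- f)); split; lia.
- by case: (nd (- e) f); split; lia.
- by left; split; [right|right]; lia.
- by case: (nd f e); split; lia.
- by right; split; [left|right]; lia.
- by right; split; [right|left]; lia.
- by case: (nd (- f) (- e)); split; lia.
Qed.

(** * Characteristic 5 and the value of Gamma *)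

Lemma coef_1DXn (R : comNzRingType) (n i : nat) :
  ((1 + 'X) ^+ n : {poly R})`_i = 'C(n, i)%:R.
Proof.
rewrite exprDn coef_sum.
under eq_bigr do rewrite expr1n mul1r coefMn coefXn.
have [lein|ltni] := leqP i n.
  rewrite (bigD1 (Ordinal (lein : (i < n.+1)%N))) //= eqxx big1 ?addr0 // => j.
  by rewrite -val_eqE /= eq_sym => /negPf ->; rewrite mul0rn.
rewrite bin_small // big1 // => j _; rewrite gtn_eqF ?mul0rn //.
by have := ltn_ord j; lia.
Qed.

(** A case of Lucas' congruence: in characteristic 5 the power of [1 + 'X] is
    [(1 + 'X^5) ^ a * (1 + 'X) ^ 2], and only the term [2 'X] of the last factor reaches an exponent
    congruent to 1 modulo 5. *)
Lemma bin_5mul (R : comNzRingType) (a b : nat) : 5 = 0 :> R ->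
  'C(5 * a + 2, 5 * b + 1)%:R = 2 * 'C(a, b)%:R :> R.
Proof.
move=> five0; rewrite -coef_1DXn exprD exprM.
have -> : (1 + 'X) ^+ 5 = 1 + 'X^5 :> {poly R}.
  have -> : (1 + 'X) ^+ 5
      = 1 + 'X^5 + 5%:P * ('X + 2 * 'X^2 + 2 * 'X^3 + 'X^4) :> {poly R}.
    by rewrite polyC_natr; ring.
  by rewrite five0 mul0r addr0.
have -> : (1 + 'X^5) ^+ a = ((1 + 'X) ^+ a) \Po 'X^5 :> {poly R}.
  by rewrite rmorphXn /= comp_polyD comp_polyX -polyC1 comp_polyC.
set p := _ \Po _.
have -> : p * (1 + 'X) ^+ 2 = p + 2%:P * (p * 'X) + p * 'X * 'X.
  by rewrite polyC_natr; ring.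
rewrite !coefD coefCM !coefMX addn1 /= !coef_comp_poly_Xn // dvdn_mulr //.
rewrite mulKn // !coef_1DXn.
have -> : (5 %| (5 * b).+1)%N = false by lia.
rewrite add0r; case: eqP => [_|nb]; first by rewrite addr0.
have -> : (5 %| (5 * b).-1)%N = false.
  apply/negP => /dvdnP[c cE]; lia.
by rewrite addr0.
Qed.

Section JacobsthalModulo.
Variables (K : finFieldType) (m : nat).
Hypothesis cardK : #|K| = m.*2.*2.+1.
Local Notation chi := (@quadchar K).

(* Euler's criterion turns the character sum into power sums; of the binomial
   expansion of (x^2 + k)^(2m) only the middle term survives. *)
Lemma jacobsthal_char (k : K) :
  (jacobsthal k)%:~R = - ('C(m.*2, m)%:R * k ^+ m).
Proof.
have m0 : (0 < m)%N by have := half_card_gt0 cardK; rewrite double_gt0.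
rewrite /jacobsthal rmorph_sum /=.
have E (x : K) : (chi (x ^+ 3 + k * x))%:~R
    = \sum_(i < m.*2.+1) ('C(m.*2, i)%:R * k ^+ i) * x ^+ (m.*2 + 2 * (m.*2 - i)).
  rewrite (quadchar_exp cardK).
  have -> : x ^+ 3 + k * x = x * (x ^+ 2 + k) by ring.
  rewrite exprMn exprDn mulr_sumr; apply: eq_bigr => i _.
  by rewrite -exprM exprD -mulr_natr; ring.
under eq_bigr do rewrite E.
rewrite exchange_big /=; under eq_bigr => i _.
  rewrite -mulr_sumr (sum_expf cardK); last by have := ltn_ord i; lia.
  over.
(* The exponent [m.*2 + 2 * (m.*2 - i)] lies between 2m and 6m, so 4m divides it only for
   [i = m]. *)
have mlt : (m < m.*2.+1)%N by lia.
rewrite (bigD1 (Ordinal mlt)) //= big1 ?addr0 => [|i].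
  have -> : (m.*2 + 2 * (m.*2 - m) = m.*2.*2)%N by lia.
  by rewrite dvdnn mulrN1.
rewrite -val_eqE /= => /eqP im; case: ifP => [/dvdnP[c cE]|_]; last by rewrite mulr0.
have := ltn_ord i; move: (i : nat) im cE => {i E} i im cE ilt; exfalso; apply: im.
by case: c cE => [|[|c]]; rewrite ?mulSn; lia.
Qed.

End JacobsthalModulo.

Definition quarter (n : nat) : nat := ((5 ^ n).-1 %/ 4)%N.

Lemma quarterE n : (5 ^ n = (quarter n).*2.*2.+1)%N.
Proof.
rewrite /quarter; have : (5 ^ n %% 4 = 1)%N by rewrite -modnXm exp1n.
have : (0 < 5 ^ n)%N by rewrite expn_gt0.
by move: (5 ^ n)%N => q; lia.
Qed.

Lemma quarterS n : quarter n.+1 = (5 * quarter n).+1.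
Proof. by have := quarterE n.+1; rewrite expnS quarterE; lia. Qed.

Lemma odd_quarter n : odd (quarter n) = odd n.
Proof. by elim: n => // n IHn; rewrite quarterS /= oddM /= IHn. Qed.

(** In base 5, [quarter n] has [n] digits 1 and its double has [n] digits 2, so each digit
    contributes a factor ['C(2, 1) = 2]. *)
Lemma bin_quarter (R : comNzRingType) n : 5 = 0 :> R ->
  'C((quarter n).*2, quarter n)%:R = 2 ^+ n :> R.
Proof.
move=> five0; elim: n => [//|n IHn].
have -> : ((quarter n.+1).*2 = 5 * (quarter n).*2 + 2)%N by rewrite quarterS; lia.
by rewrite quarterS -[(5 * _).+1]addn1 bin_5mul // IHn exprS.
Qed.

(** Modulo 5 the square of [1 + 2i] is [2 (1 + 2i)], so its power [n.+1] is [2 ^ n (1 + 2i)]. This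
    fails for exponent 0, whence the successor. *)
Lemma gauss_pow_char5 (R : comNzRingType) n : 5 = 0 :> R ->
  2 * ((gauss_pow n.+1).1)%:~R = 2 ^+ n.+1 :> R
  /\ ((gauss_pow n.+1).2)%:~R = 2 * ((gauss_pow n.+1).1)%:~R :> R.
Proof.
move=> five0; elim: n => [|n].
  by split; rewrite /= ?mulr1 ?mulr0 ?subr0 ?addr0 ?expr1 ?mul1r.
rewrite [gauss_pow n.+2]gauss_powS; move: (gauss_pow n.+1) => [a b] [aE bE].
rewrite /= in aE bE *.
rewrite [2 ^+ n.+2]exprS -aE !rmorphB !rmorphD !rmorphM /= bE.
split.
  have -> : 2 * (a%:~R - 2%:~R * (2 * a%:~R))
      = 2 * (2 * a%:~R) - 5 * (2 * a%:~R) :> R by ring.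
  by rewrite five0 mul0r subr0.
have -> : 2%:~R * a%:~R + 2 * a%:~R
    = 2 * (a%:~R - 2%:~R * (2 * a%:~R)) + 5 * (2 * a%:~R) :> R by ring.
by rewrite five0 mul0r addr0.
Qed.

(** * The closed form of [Gamma K] *)

Section CharacteristicFive.
Variables (K : finFieldType) (n : nat).
Hypothesis cardK : #|K| = (5 ^ n)%N.
Local Notation chi := (@quadchar K).

Lemma five_eq0 : 5 = 0 :> K.
Proof. by have /pcharf0 := card_finPcharP cardK isT. Qed.

Lemma card_quarter : #|K| = (quarter n).*2.*2.+1.
Proof. by rewrite cardK quarterE. Qed.

Lemma quadcharN1 : chi (-1) = 1.
Proof.
have h0 := half_card_gt0 card_quarter.
have N1_neq0 : -1 != 0 :> K by rewrite oppr_eq0 oner_neq0.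
have := quadchar_exp card_quarter (-1 : K).
rewrite -muln2 mulnC exprM sqrrN expr1n expr1n.
case: (quadchar_sign N1_neq0) => -> // /eqP.
by rewrite eq_sym (negPf (one_neqN1 card_quarter)).
Qed.

(** 2 is a square root of -1, so Euler's criterion gives [(-1) ^ quarter n], and [quarter n] has the
    parity of [n]. *)
Lemma quadchar2 : chi 2 = if odd n then -1 else 1.
Proof.
have E2 : (2 : K) ^+ 2 = -1.
  have -> : (2 : K) ^+ 2 = 5 - 1 by ring.
  by rewrite five_eq0 sub0r.
have := quadchar_exp card_quarter (2 : K).
rewrite -mul2n exprM E2 -signr_odd odd_quarter.
have ne1 := one_neqN1 card_quarter.
have [->|->] := quadchar_sign (two_neq0 card_quarter); case: odd => //= /eqP.
  by rewrite expr1 (negPf ne1).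
by rewrite expr0 eq_sym (negPf ne1).
Qed.

Lemma Gamma_jacobsthal : Gamma K = jacobsthal (-1 : K).
Proof. by apply: eq_bigr => x _; congr quadchar; ring. Qed.

Lemma Gamma_sum_squares : exists b, Gamma K ^+ 2 + b ^+ 2 = 4 * 5 ^+ n :> int.
Proof.
have [g gN] := nonsquare_exists card_quarter.
exists (jacobsthal g); rewrite Gamma_jacobsthal.
rewrite (jacobsthal_two_squares card_quarter quadcharN1 gN) -quarterE.
by rewrite -[(5 ^ n)%N%:Z]natz natrX.
Qed.

Lemma Gamma_char5 : (Gamma K)%:~R = - (-1) ^+ n * 2 ^+ n :> K.
Proof.
rewrite Gamma_jacobsthal (jacobsthal_char card_quarter) bin_quarter ?five_eq0 //.
by rewrite -[X in _ * X]signr_odd odd_quarter signr_odd; ring.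
Qed.

Lemma degree_gt0 : (0 < n)%N.
Proof. by have := finNzRing_gt1 K; rewrite cardK; case: n. Qed.

Lemma Gamma_gauss_pow : Gamma K = (-1) ^+ n.+1 * (2 * (gauss_pow n).1).
Proof.
have [b0 E] := Gamma_sum_squares.
have [a [b [GE bE]]] := sum_sqr_mod4 E.
have two0 := two_neq0 card_quarter; have five0 := five_eq0.
have GK := Gamma_char5; rewrite GE rmorphM rmorph_nat in GK.
have pow0 : (2 : K) ^+ n != 0 by rewrite expf_neq0.
have sgn0 : (-1) ^+ n != 0 :> K by rewrite expf_neq0 // oppr_eq0 oner_neq0.
have Eab : a ^+ 2 + b ^+ 2 = 5 ^+ n.
  by move: E; rewrite GE bE; move: (5 ^+ n) => p; clear; nia.
(* If 5 divided [a], then [Gamma K] would vanish in [K], where it is a power of 2 up to sign. *)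
have nd (x y : int) : ~ (a = 5 * x /\ b = 5 * y).
  case=> aE _; move/eqP: GK; rewrite aE rmorphM rmorph_nat five0 mul0r mulr0 eq_sym.
  by rewrite mulf_eq0 oppr_eq0 (negPf pow0) (negPf sgn0).
have := gauss_pow_unique Eab nd; have := @gauss_pow_char5 K n.-1 five0.
rewrite prednK ?degree_gt0 //; case: (gauss_pow n) => c d /= [cK dK].
have mul3 (u : K) : 3 * u = 0 -> u = 0.
  have -> : 3 * u = 5 * u - 2 * u by ring.
  rewrite five0 mul0r sub0r => /eqP.
  by rewrite oppr_eq0 mulf_eq0 (negPf two0) => /eqP.
(* Excludes the imaginary part: [d] is [2 * c] in [K], so twice a sign would be a sign there, and
   squaring gives 4 = 1. *)
have bad (f : int) : f = 1 \/ f = -1 -> a <> f * d.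
  move=> fE aE; move: GK; rewrite aE rmorphM /= dK.
  have -> : 2 * (f%:~R * (2 * c%:~R)) = 2 * f%:~R * (2 * c%:~R) :> K by ring.
  have f2 : f%:~R ^+ 2 = 1 :> K.
    by case: fE => ->; rewrite ?mulrN1z ?sqrrN expr1n.
  rewrite cK => /(mulIf pow0) /(congr1 (fun z => z ^+ 2)).
  rewrite sqrrN sqrr_sign exprMn f2 mulr1 => four1.
  move/eqP: (oner_neq0 K); apply; apply: mul3.
  by transitivity (2 ^+ 2 - 1 : K); [ring | rewrite four1 subrr].
(* For the real part, comparison in [K] determines the sign [f]. *)
have signs (f : int) : a = f * c -> f%:~R = - (-1) ^+ n :> K.
  by move=> aE; apply: (mulIf pow0); rewrite -GK aE rmorphM /= -cK; ring.
have ne1 := one_neqN1 card_quarter.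
have goal_of (f : int) : f = 1 \/ f = -1 -> a = f * c -> 
    2 * a = (-1) ^+ n.+1 * (2 * c).
  move=> fE aE; have := signs f aE; rewrite aE exprS -!(signr_odd _ n).
  case: fE => -> ; case: (odd n); rewrite ?expr0 ?expr1 ?opprK => /eqP;
   rewrite ?mulrN1z ?mulr1z ?(negPf ne1) 1?eq_sym ?(negPf ne1) // => _; ring.
rewrite GE; case=> [[[aE|aE] _]|[[aE|aE] _]].
- by apply: (goal_of 1); [left|rewrite mul1r].
- by apply: (goal_of (-1)); [right|rewrite mulN1r].
- by case: (bad 1); [left|rewrite mul1r].
- by case: (bad (-1)); [right|rewrite mulN1r].
Qed.

Lemma Gamma_closed_form : Gamma K = (-1) ^+ n.+1 *
  \sum_(0 <= k < (n %/ 2).+1) (-1) ^+ k * ('C(n, 2 * k) * 2 ^ (2 * k + 1))%:R.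
Proof.
have [|E _] := @gauss_pow_binomial n (n %/ 2).+1; first by lia.
rewrite Gamma_gauss_pow E !mulr_sumr; apply: eq_bigr => k _.
by rewrite addn1 expnS mulnCA natrM; ring.
Qed.

End CharacteristicFive.

(** * Fibers of F (x + 1) + F x *)

Lemma card_le_indicator (T : finType) (A : {set T}) (P : bool) :
  (forall x, x \in A -> P) -> (#|A| <= 1)%N -> (#|A| <= P)%N.
Proof.
move=> AP; case: P AP => // AP _.
by rewrite leqn0 cards_eq0; apply/eqP/setP => x; rewrite in_set0; apply/negP => /AP.
Qed.

Lemma sum_indicator (T : finType) (c : T) : \sum_b (b == c)%:R = 1 :> int.
Proof. by rewrite (bigD1 c) //= eqxx big1 ?addr0 // => b /negPf ->. Qed.

Section Fibers.
Variables (K : finFieldType) (n : nat).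
Hypothesis cardK : #|K| = (5 ^ n)%N.
Local Notation chi := (@quadchar K).
Local Notation F := (fun x : K => x ^+ ((5 ^ n - 3) %/ 2)).
Let five0 := five_eq0 cardK.
Let two0 := two_neq0 (card_quarter cardK).
Let chiM := quadcharM (card_quarter cardK).
Let chiV := quadcharV (card_quarter cardK).
Let chiN := quadcharN (card_quarter cardK) (quadcharN1 cardK).
Let chi_sqr := @quadchar_sqr K.

Lemma half_exponent : ((5 ^ n - 3) %/ 2).+1 = (quarter n).*2.
Proof.
have := half_card_gt0 (card_quarter cardK); rewrite quarterE.
by move: (quarter n) => m; lia.
Qed.

Lemma power_mapE (x : K) : F x = (chi x)%:~R / x.
Proof.
have [->|x0] := eqVneq x 0.
  (* The exponent is not 0, since its successor is even. *)
  rewrite quadchar0 mul0r expr0n; have := half_exponent.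
  by case: (_ %/ _)%N => // H; exfalso; lia.
apply: (mulIf x0); rewrite mulfVK // -exprSr half_exponent.
by rewrite (quadchar_exp (card_quarter cardK)).
Qed.

(** As -1 is a square, the sign [(chi x)%:~R] does not affect the character of a product. *)
Lemma quadchar_signr (x : K) : chi (chi x)%:~R = 1 \/ chi x = 0.
Proof.
by case: (quadcharP x) => [_|y _ _|_];
  [right|left; rewrite quadchar1|left; rewrite mulrN1z chiN quadchar1].
Qed.

Definition fiber (b : K) := [set x : K | F (x + 1) - -1 * F x == b].

Lemma cdelta_fiber b : cdelta (-1) F 1 b = #|fiber b|.
Proof. by []. Qed.

Lemma fiberE b x :
  (x \in fiber b) = ((chi (x + 1))%:~R / (x + 1) + (chi x)%:~R / x == b).
Proof. by rewrite inE !power_mapE mulN1r opprK. Qed.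

Lemma fiber_diff (b x : K) : x != 0 -> x + 1 != 0 -> chi (x + 1) = - chi x ->
  x \in fiber b -> b * (x * (x + 1)) = (chi x)%:~R.
Proof.
by move=> x0 x10 E; rewrite fiberE E => /eqP <-; rewrite rmorphN /=; field; rewrite x0.
Qed.

Lemma fiber_same (b x : K) : x != 0 -> x + 1 != 0 -> chi (x + 1) = chi x ->
  x \in fiber b -> b * (x * (x + 1)) = (chi x)%:~R * (2 * x + 1).
Proof.
by move=> x0 x10 E; rewrite fiberE E => /eqP <-; field; rewrite x0.
Qed.

(* In characteristic 5, x^2 + x - 1 = (x + 3)^2. *)
Lemma fiber_diff_chi (b x : K) : x != 0 -> x + 1 != 0 -> chi (x + 1) = - chi x ->
  x \in fiber b -> chi b = -1 /\ chi (b - (chi x)%:~R) = -1.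
Proof.
move=> x0 x10 E /(fiber_diff x0 x10 E).
have xx0 : x * (x + 1) != 0 by rewrite mulf_neq0.
have cxx : chi (x * (x + 1)) = -1.
  by rewrite chiM E mulrN (quadchar_sqrE (card_quarter cardK)).
(* Otherwise [x = 2] and [x + 1 = -2], which have the same character. *)
have x3 : x + 3 != 0.
  apply/eqP => x3; move: E; have -> : x = 2.
    apply/eqP; rewrite -subr_eq0; have -> : x - 2 = x + 3 - 5 by ring.
    by rewrite x3 five0 subr0.
  have -> : 2 + 1 = - (2 - 5) :> K by ring.
  rewrite five0 subr0 chiN.
  by have [] := quadchar_sign two0 => ->.
set e := (chi x)%:~R => bE.
have chie : chi e = 1.
  by have [] := quadchar_signr x => // /eqP; rewrite quadchar_eq0 (negPf x0).
have eN : e ^+ 2 = 1.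
  rewrite /e; have [] := quadchar_sign x0 => ->; first by rewrite expr1n.
  by rewrite mulrN1z sqrrN expr1n.
have neg (z : K) : chi (z * (x * (x + 1))) = 1 -> chi z = -1.
  by rewrite chiM cxx; lia.
split; apply: neg; first by rewrite bE.
rewrite mulrBl bE.
have -> : e - e * (x * (x + 1)) = - (e * ((x + 3) ^+ 2 - 5 * (x + 2))) by ring.
by rewrite five0 mul0r subr0 chiN chiM chie chi_sqr // mulr1.
Qed.

(* In characteristic 5, x^2 - x - 1 = (x + 2)^2 and x^2 + 3x + 1 = (x - 1)^2. *)
Lemma fiber_same_sqr (b x : K) : x != 0 -> x + 1 != 0 -> chi (x + 1) = chi x ->
  x \in fiber b ->
  (b - 1) * (x * (x + 1)) = - (if chi x == 1 then (x + 2) ^+ 2 else (x - 1) ^+ 2)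
  /\ (b + 1) * (x * (x + 1)) = (if chi x == 1 then (x - 1) ^+ 2 else (x + 2) ^+ 2).
Proof.
move=> x0 x10 E /(fiber_same x0 x10 E) bE; rewrite mulrBl mulrDl bE mul1r.
have [] := quadchar_sign x0 => ->; rewrite ?eqxx /=.
  split.
    have -> : 1%:~R * (2 * x + 1) - x * (x + 1) = - ((x + 2) ^+ 2) + 5 * (x + 1) by ring.
    by rewrite five0 mul0r addr0.
  have -> : 1%:~R * (2 * x + 1) + x * (x + 1) = (x - 1) ^+ 2 + 5 * x :> K by ring.
  by rewrite five0 mul0r addr0.
split.
  have -> : -1%:~R * (2 * x + 1) - x * (x + 1) = - ((x - 1) ^+ 2) - 5 * x :> K by ring.
  by rewrite five0 mul0r subr0.
have -> : -1%:~R * (2 * x + 1) + x * (x + 1) = (x + 2) ^+ 2 - 5 * (x + 1) :> K by ring.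
by rewrite five0 mul0r subr0.
Qed.

(** * Splitting a fiber by the characters of [x] and [x + 1] *)

Definition fiber_poles (b : K) := [set x in fiber b | (x == 0) || (x + 1 == 0)].
Definition fiber_diffs (e : int) (b : K) :=
  [set x in fiber b | [&& x != 0, x + 1 != 0, chi x == e & chi (x + 1) == - e]].
Definition fiber_sames (b : K) :=
  [set x in fiber b | [&& x != 0, x + 1 != 0 & chi (x + 1) == chi x]].

Lemma fiber_cover b : fiber b \subset
  fiber_poles b :|: fiber_sames b :|: fiber_diffs 1 b :|: fiber_diffs (-1) b.
Proof.
apply/subsetP => x xb; rewrite !in_setU [x \in fiber_poles _]in_set.
rewrite [x \in fiber_sames _]in_set ![x \in fiber_diffs _ _]in_set xb /=.
have [//|x0] := eqVneq x 0; have [//|x10] := eqVneq (x + 1) 0.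
by have [->|->] := quadchar_sign x0; have [->|->] := quadchar_sign x10.
Qed.

(** Since [F 1 = 1] and [F (-1) = -1], the point 0 lies over 1 and the point -1 over -1. *)
Lemma card_fiber_poles b : (#|fiber_poles b| <= (b == 1%R) + (b == (-1)%R))%N.
Proof.
have sub : fiber_poles b \subset
    [set x : K | (x == 0) && (b == 1)] :|: [set x : K | (x == -1) && (b == -1)].
  apply/subsetP => x; rewrite in_set fiberE // => /andP[E].
  case/orP=> /eqP x0; move: E; rewrite !inE.
    rewrite x0 add0r quadchar1 quadchar0 mul0r addr0 invr1 mulr1 => /eqP <-.
    by rewrite !eqxx.
  have -> : x = -1 by rewrite -[LHS](addrK 1) x0 sub0r.
  rewrite addNr quadchar0 mul0r add0r (quadcharN1 cardK) invrN1 mul1r => /eqP <-.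
  by rewrite !eqxx orbT.
apply: leq_trans (subset_leq_card sub) _; apply: leq_trans (leq_card_setU _ _) _.
apply: leq_add; apply: card_le_indicator => [x|]; rewrite ?inE; try by case/andP.
  by apply/card_le1_eqP => x y; rewrite !inE => /andP[/eqP -> _] /andP[/eqP ->].
by apply/card_le1_eqP => x y; rewrite !inE => /andP[/eqP -> _] /andP[/eqP ->].
Qed.

Lemma eq_mul_succ (x y : K) :
  x * (x + 1) = y * (y + 1) -> x = y \/ x = - (y + 1).
Proof.
move=> E; have /eqP : (x - y) * (x + (y + 1)) = 0.
  by transitivity (x * (x + 1) - y * (y + 1)); [ring | rewrite E subrr].
by rewrite mulf_eq0 subr_eq0 addr_eq0 => /orP[] /eqP; [left|right].
Qed.

Lemma card_fiber_diffs (e : int) b :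
  (#|fiber_diffs e b| <= (chi b == -1)%R && (chi (b - e%:~R) == -1)%R)%N.
Proof.
apply: card_le_indicator => [x|].
  rewrite in_set => /andP[xb /and4P[x0 x10 /eqP xe /eqP x1e]]; rewrite -xe.
  by have [|-> ->] := fiber_diff_chi x0 x10 _ xb; rewrite ?x1e ?xe.
apply/card_le1_eqP => x y; rewrite [x \in _]in_set [y \in _]in_set.
move=> /andP[xb /and4P[x0 x10 /eqP xe /eqP x1e]].
move=> /andP[yb /and4P[y0 y10 /eqP ye /eqP y1e]].
have Ex := fiber_diff x0 x10 (etrans x1e (congr1 _ (esym xe))) xb.
have Ey := fiber_diff y0 y10 (etrans y1e (congr1 _ (esym ye))) yb.
have b0 : b != 0.
  apply/eqP => b0; move: Ex; rewrite b0 mul0r => /esym Z.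
  have := quadchar_signr x; rewrite Z quadchar0 => -[//|/eqP].
  by rewrite quadchar_eq0 (negPf x0).
(* The value of [x * (x + 1)] determines [x] up to the reflection to [- (x + 1)]. On this set the
   reflection reverses the character, so it leaves the set. *)
have [//|xy] : x = y \/ x = - (y + 1).
  by apply/eq_mul_succ/(mulfI b0); rewrite Ex Ey xe ye.
have e0 : e = 0 by move: xe; rewrite xy chiN y1e; clear; lia.
by move/eqP: xe; rewrite e0 quadchar_eq0 (negPf x0).
Qed.

(** Over 0 the only candidate is [x = 2], the root of [2 * x + 1]. Over 1 and -1 the only candidates
    are [x = -2] and [x = 1], which require 2 to be a square, that is, even [n]. *)
Definition fiber_sames_bound (b : K) : nat :=
  if b == 0 then 1%N else if (b == 1) || (b == -1) then nat_of_bool (~~ odd n)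
  else if (chi (b - 1) == 1) && (chi (b + 1) == 1) then 2%N else 0%N.

Lemma double_succ_neq0 (b x : K) : b != 0 -> x \in fiber_sames b -> 2 * x + 1 != 0.
Proof.
move=> b0; rewrite in_set => /andP[xb /and3P[x0 x10 /eqP E]].
have bE := fiber_same x0 x10 E xb; apply/eqP => u0; move/eqP: bE.
by rewrite u0 mulr0 !mulf_eq0 (negPf b0) (negPf x0) (negPf x10).
Qed.

(* With u = 2x + 1, the two formulas are u |-> -1/u and u |-> 1/u. *)
Definition fiber_mate (x : K) : K :=
  if chi (2 * x + 1) == 1 then - (x + 1) / (2 * x + 1) else - x / (2 * x + 1).

Lemma fiber_sames_mate (b x y : K) : b != 0 ->
  x \in fiber_sames b -> y \in fiber_sames b -> y = x \/ y = fiber_mate x.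
Proof.
move=> b0 xA yA; have ux := double_succ_neq0 b0 xA.
(* Eliminating [b] between the equations of [x] and [z] leaves the factor [x - z] and one that is
   linear in [z]. *)
have root (e z : K) : b * (x * (x + 1)) = e * (2 * x + 1) ->
    b * (z * (z + 1)) = e * (2 * z + 1) -> z = x \/ z = - (x + 1) / (2 * x + 1).
  move=> Ex Ez; have /eqP : b * ((x - z) * (z * (2 * x + 1) + (x + 1))) = 0.
    transitivity (b * (x * (x + 1)) * (2 * z + 1) - b * (z * (z + 1)) * (2 * x + 1)).
      by ring.
    by rewrite Ex Ez; ring.
  rewrite !mulf_eq0 (negPf b0) subr_eq0 addr_eq0 /=.
  case/orP=> /eqP zE; first by left; rewrite zE.
  by right; rewrite -zE mulfK.
move: xA yA; rewrite [x \in _]in_set [y \in _]in_set.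
move=> /andP[xb /and3P[x0 x10 /eqP xE]] /andP[yb /and3P[y0 y10 /eqP yE]].
have bx := fiber_same x0 x10 xE xb; have bb := fiber_same y0 y10 yE yb.
have [cxy|cxy] : chi y = chi x \/ chi y = - chi x.
- by have [->|->] := quadchar_sign x0; have [->|->] := quadchar_sign y0;
    [left|right|right|left].
- rewrite cxy in bb; have [|yM] := root _ _ bx bb; [by left|right].
  rewrite /fiber_mate; suff -> : chi (2 * x + 1) = 1 by rewrite eqxx.
  move: cxy; rewrite {1}yM chiM chiV chiN xE.
  by have [->|->] := quadchar_sign x0; clear; lia.
rewrite cxy rmorphN /= in bb.
(* The reflection to [- (y + 1)] keeps [y * (y + 1)] and negates [2 * y + 1], so it solves the
   equation of [x] when the characters of [x] and [y] are opposite. *)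
have bb' : b * (- (y + 1) * (- (y + 1) + 1)) = (chi x)%:~R * (2 * (- (y + 1)) + 1).
  transitivity (b * (y * (y + 1))); first by ring.
  by rewrite bb; ring.
have [yM|yM] := root _ _ bx bb'.
  move: yE; rewrite -[chi (y + 1)]chiN yM cxy.
  by have [->|->] := quadchar_sign x0.
have {}yM : y = - x / (2 * x + 1).
  have -> : y = - (- (y + 1)) - 1 by ring.
  by rewrite yM; field.
right; rewrite /fiber_mate; suff -> : chi (2 * x + 1) = -1 by [].
move: cxy; rewrite {1}yM chiM chiV chiN.
by have [->|->] := quadchar_sign x0; clear; lia.
Qed.

Lemma card_fiber_sames b : (#|fiber_sames b| <= fiber_sames_bound b)%N.
Proof.
rewrite /fiber_sames_bound; have [->|b0] := eqVneq b 0.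
  apply/card_le1_eqP => x y; rewrite [x \in _]in_set [y \in _]in_set.
  move=> /andP[xb /and3P[x0 x10 /eqP xE]] /andP[yb /and3P[y0 y10 /eqP yE]].
  have bx := fiber_same x0 x10 xE xb; have bb := fiber_same y0 y10 yE yb.
  have zero (z : K) : z != 0 -> 0 * (z * (z + 1)) = (chi z)%:~R * (2 * z + 1) ->
      z = 2.
    move=> z0; rewrite mul0r => /esym/eqP; rewrite mulf_eq0.
    have -> : (chi z)%:~R == 0 :> K = false.
      apply/negP => /eqP Z; have := quadchar_signr z; rewrite Z quadchar0.
      by case=> // /eqP; rewrite quadchar_eq0 (negPf z0).
    move/eqP => u0; have : 2 * (z - 2) = 0.
      have -> : 2 * (z - 2) = 2 * z + 1 - 5 by ring.
      by rewrite u0 five0 subr0.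
    by move/eqP; rewrite mulf_eq0 (negPf two0) subr_eq0 => /eqP.
  by rewrite (zero x x0 bx) (zero y y0 bb).
case: ifP => [b1|/norP[bn1 bnN1]].
  (* One left-hand side of [fiber_same_sqr] vanishes here, so [x] is 1 or -2; comparing the
     characters of [x] and [x + 1] leaves one of them. *)
  have [c Hc] : exists c : K, forall x, x \in fiber_sames b -> x = c /\ ~~ odd n.
    have even2 : chi 2 = 1 -> ~~ odd n by rewrite (quadchar2 cardK); case: odd.
    exists (if b == 1 then -2 else 1) => x.
    rewrite in_set => /andP[xb /and3P[x0 x10 /eqP xE]].
    have [] := fiber_same_sqr x0 x10 xE xb.
    case/orP: b1 => /eqP ->.
      rewrite eqxx subrr mul0r => /esym/eqP; rewrite oppr_eq0 => Z _; move: Z.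
      have [c1|c1] := quadchar_sign x0; rewrite c1 /= expf_eq0 /=.
        rewrite addr_eq0 => /eqP xN2; split=> //; apply: even2.
        by rewrite -chiN -xN2.
      by rewrite subr_eq0 => /eqP x1; move: c1; rewrite x1 quadchar1.
    rewrite [-1 == 1 :> K]eq_sym (negPf (one_neqN1 (card_quarter cardK))).
    rewrite addNr mul0r => _ /esym/eqP.
    have [c1|c1] := quadchar_sign x0; rewrite c1 /= expf_eq0 /=.
      rewrite subr_eq0 => /eqP x1; split=> //; apply: even2.
      by rewrite -c1 -xE x1.
    rewrite addr_eq0 => /eqP xN2; move: xE.
    have -> : x + 1 = -1 by rewrite xN2; ring.
    by rewrite (quadcharN1 cardK) c1.
  apply: card_le_indicator => [x /Hc[]//|].
  by apply/card_le1_eqP => x y /Hc[-> _] /Hc[-> _].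
have [->|[x xA]] := set_0Vmem (fiber_sames b); first by rewrite cards0.
have -> : (chi (b - 1) == 1) && (chi (b + 1) == 1).
  move: xA; rewrite in_set => /andP[xb /and3P[x0 x10 /eqP xE]].
  have cxx : chi (x * (x + 1)) = 1.
    by rewrite chiM xE (quadchar_sqrE (card_quarter cardK)).
  have sq (z s : K) : z != 0 -> chi (z * (x * (x + 1))) = chi (s ^+ 2) -> chi z == 1.
    move=> z0; rewrite chiM cxx mulr1 => zs; rewrite zs chi_sqr //.
    by apply: contra_neq z0 => s0; apply/eqP;
      rewrite -quadchar_eq0 zs s0 expr0n /= quadchar0.
  have [E1 E2] := fiber_same_sqr x0 x10 xE xb.
  rewrite (sq _ (if chi x == 1 then x + 2 else x - 1)) ?subr_eq0 //; last first.
    by rewrite E1 chiN; case: ifP.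
  rewrite (sq _ (if chi x == 1 then x - 1 else x + 2)) ?addr_eq0 //.
  by rewrite E2; case: ifP.
have sub : fiber_sames b \subset [set x; fiber_mate x].
  apply/subsetP => y yA; rewrite !inE.
  by have [->|->] := fiber_sames_mate b0 xA yA; rewrite eqxx ?orbT.
by apply: leq_trans (subset_leq_card sub) _; rewrite cards2 ltnS leq_b1.
Qed.


(** * Summing the bounds on the fibers *)

Definition fiber_bound (b : K) : nat :=
  ((b == 1%R) + (b == (-1)%R) + fiber_sames_bound b
   + ((chi b == -1)%R && (chi (b - 1) == -1)%R)
   + ((chi b == -1)%R && (chi (b + 1) == -1)%R))%N.

Lemma card_fiber_le b : (#|fiber b| <= fiber_bound b)%N.
Proof.
apply: leq_trans (subset_leq_card (fiber_cover b)) _.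
apply: leq_trans (leq_card_setU _ _) (leq_add _ _); last first.
  by have := card_fiber_diffs (-1) b; rewrite mulrN1z opprK.
apply: leq_trans (leq_card_setU _ _) (leq_add _ _); last exact: card_fiber_diffs.
apply: leq_trans (leq_card_setU _ _) (leq_add _ _); last exact: card_fiber_sames.
exact: card_fiber_poles.
Qed.

Lemma quadchar_at1 : (chi (1 - 1) = 0) * (chi 1 = 1) * (chi (1 + 1) = chi 2).
Proof. by rewrite subrr quadchar0 quadchar1. Qed.

Lemma quadchar_atN1 : (chi (-1 - 1) = chi 2) * (chi (-1) = 1) * (chi (-1 + 1) = 0).
Proof. by rewrite addNr quadchar0 (quadcharN1 cardK) -opprD chiN. Qed.

Lemma quadchar_at0 : (chi (0 - 1) = 1) * (chi 0 = 0) * (chi (0 + 1) = 1).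
Proof. by rewrite !add0r quadchar0 quadchar1 (quadcharN1 cardK). Qed.

(* The summands chi (b + 0) put every product in the form of sum_quadchar_pair. *)
Definition bound_char (b : K) : int :=
  4 + chi (b - 1) + chi (b + 1) - 2 * chi b + 2 * (chi (b - 1) * chi (b + 1))
  + chi (b - 1) * chi (b + 0) + chi (b + 0) * chi (b + 1).

Variant special_spec (b : K) : bool -> bool -> bool -> Prop :=
  | SpecialZero of b = 0 : special_spec b true false false
  | SpecialOne of b = 1 : special_spec b false true false
  | SpecialNeg of b = -1 : special_spec b false false true
  | SpecialNone of b != 0 & b - 1 != 0 & b + 1 != 0 : special_spec b false false false.

Lemma specialP b : special_spec b (b == 0) (b == 1) (b == -1).
Proof.
have ne1 := one_neqN1 (card_quarter cardK).
have [->|b0] := eqVneq b 0.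
  by rewrite eq_sym oner_eq0 eq_sym oppr_eq0 oner_eq0; constructor.
have [->|b1] := eqVneq b 1; first by rewrite (negPf ne1); constructor.
have [->|bN1] := eqVneq b (-1); first by constructor.
by constructor; rewrite ?subr_eq0 ?addr_eq0.
Qed.

(** Off 0, 1 and -1, each sign condition is a product of factors [(1 + chi _) / 2] or
    [(1 - chi _) / 2]; expanding gives [bound_char]. The last terms correct the three exceptional
    points. *)
Lemma fiber_bound_char b : 4 * (fiber_bound b)%:Z =
  bound_char b - 4 * (b == 0)%:R + 4 * (b == 1)%:R + 4 * (b == -1)%:R.
Proof.
rewrite /fiber_bound /bound_char /fiber_sames_bound addr0.
case: specialP => [->|->|->|b0 b1 bN1] /=.
- by rewrite !quadchar_at0.
- by rewrite !quadchar_at1 (quadchar2 cardK); case: (odd n).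
- by rewrite !quadchar_atN1 (quadchar2 cardK); case: (odd n).
by have [->|->] := quadchar_sign b0; have [->|->] := quadchar_sign b1;
  have [->|->] := quadchar_sign bN1.
Qed.

Lemma sum_bound_char : \sum_b bound_char b = 4 * (#|K|)%:Z - 4.
Proof.
have sums := sum_quadchar_shift (card_quarter cardK).
have pairs := sum_quadchar_pair (card_quarter cardK).
have N10 : -1 != 0 :> K by rewrite oppr_eq0 oner_eq0.
rewrite /bound_char !big_split /= -!mulr_sumr sumrN -!mulr_sumr.
rewrite (sum_quadchar (card_quarter cardK)) !sums !pairs ?oner_eq0 //; last first.
- by rewrite eq_sym (one_neqN1 (card_quarter cardK)).
- by rewrite eq_sym oner_eq0.
by rewrite !sumr_const !natz cardT -cardE; clear; lia.
Qed.

Lemma sum_card_fiber : (\sum_b #|fiber b| = #|K|)%N.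
Proof.
rewrite -[RHS]sum1_card [RHS](partition_big (fun x => F (x + 1) - -1 * F x) predT) //=.
by apply: eq_bigr => c _; rewrite sum1dep_card.
Qed.

(* The bounds of card_fiber_le add up to #|K|, so each of them is attained. *)
Lemma card_fiber b : #|fiber b| = fiber_bound b.
Proof.
have sumE : (\sum_b #|fiber b| = \sum_b fiber_bound b)%N.
  rewrite sum_card_fiber.
  have E : 4 * (\sum_b fiber_bound b)%N%:Z = 4 * #|K|%:Z.
    rewrite -[(\sum_b _)%N%:Z]natz natr_sum mulr_sumr.
    under eq_bigr do rewrite [(fiber_bound _)%:R]natz fiber_bound_char.
    (* The corrections -4 + 4 + 4 cancel the -4 of [sum_bound_char]. *)
    rewrite 3!big_split /= sumrN -!mulr_sumr !sum_indicator sum_bound_char; ring.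
  by lia.
have leif c (_ : true) :
    (#|fiber c| <= fiber_bound c ?= iff (#|fiber c| == fiber_bound c))%N.
  by split=> //; exact: card_fiber_le.
have [_] := leqif_sum leif.
by rewrite sumE eqxx => /esym/forallP/(_ b)/eqP.
Qed.

Lemma fiber_bound_le2 b : (fiber_bound b <= 2)%N.
Proof.
rewrite /fiber_bound /fiber_sames_bound; case: specialP => [->|->|->|b0 b1 bN1] /=.
- by rewrite !quadchar_at0.
- by rewrite !quadchar_at1; case: (odd n).
- by rewrite !quadchar_atN1; case: (odd n).
by have [->|->] := quadchar_sign b0; have [->|->] := quadchar_sign b1;
  have [->|->] := quadchar_sign bN1.
Qed.

(** The expansion of [2 (1 + chi (b - 1)) (1 + chi (b + 1))] plus [(1 - chi b) (1 - chi (b - 1)) (1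
    - chi (b + 1))]: a generic fiber has two points when [b - 1] and [b + 1] are both squares, or
    when [b] and both of them are nonsquares. The triple product is what brings in [Gamma K]. *)
Definition two_char (b : K) : int :=
  3 + chi (b - 1) + chi (b + 1) - chi b + 3 * (chi (b - 1) * chi (b + 1))
  + chi (b - 1) * chi (b + 0) + chi (b + 0) * chi (b + 1)
  - chi (b * (b - 1) * (b + 1)).

Lemma fiber_bound2_char b : 8 * (fiber_bound b == 2%N)%:R =
  two_char b - 8 * (b == 0)%:R
  + (2 + 2 * chi 2) * (b == 1)%:R + (2 + 2 * chi 2) * (b == -1)%:R.
Proof.
rewrite /fiber_bound /two_char /fiber_sames_bound addr0 !chiM.
case: specialP => [->|->|->|b0 b1 bN1] /=.
- by rewrite !quadchar_at0 !mulr0.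
- by rewrite !quadchar_at1 (quadchar2 cardK); case: (odd n).
- by rewrite !quadchar_atN1 (quadchar2 cardK); case: (odd n).
by rewrite !mulr0; have [->|->] := quadchar_sign b0; have [->|->] := quadchar_sign b1;
  have [->|->] := quadchar_sign bN1.
Qed.

Lemma sum_two_char : \sum_b two_char b = 3 * (#|K|)%:Z - 5 - Gamma K.
Proof.
have sums := sum_quadchar_shift (card_quarter cardK).
have pairs := sum_quadchar_pair (card_quarter cardK).
have N10 : -1 != 0 :> K by rewrite oppr_eq0 oner_eq0.
rewrite /two_char !big_split /= -!mulr_sumr !sumrN /Gamma.
rewrite (sum_quadchar (card_quarter cardK)) !sums !pairs ?oner_eq0 //; last first.
- by rewrite eq_sym (one_neqN1 (card_quarter cardK)).
- by rewrite eq_sym oner_eq0.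
by rewrite !sumr_const !natz cardT -cardE; ring.
Qed.

(** * The number of fibers of each size *)

Local Notation w := (comega (-1) F).

Lemma comega_sum i : (w i)%:Z = \sum_b (fiber_bound b == i)%:R.
Proof.
rewrite /comega -sum1_card -[LHS]natz natr_sum [LHS]big_mkcond /=.
by apply: eq_bigr => b _; rewrite inE cdelta_fiber card_fiber; case: eqP.
Qed.

(** The constant is -5 from the pair sums, -8 from [b = 0] and [4 + 4 * chi 2] from [b = 1] and
    [b = -1]; the parity of [n] enters only through [chi 2]. *)
Lemma comega2E : 8 * (w 2)%:Z = 3 * (5 ^+ n) - 9 + 4 * chi 2 - Gamma K.
Proof.
rewrite comega_sum mulr_sumr; under eq_bigr do rewrite fiber_bound2_char.
rewrite 3!big_split /= sumrN -!mulr_sumr !sum_indicator sum_two_char cardK.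
have -> : (5 ^ n)%N%:Z = 5 ^+ n by rewrite -[LHS]natz natrX.
ring.
Qed.

(** The fibers have at most two points and average size 1, so empty and two-point fibers are equally
    many. *)
Lemma comega02E : (w 0 = w 2)%N /\ (w 0 + w 1 + w 2 = 5 ^ n)%N.
Proof.
have card_sum : \sum_(b : K) 1 = (5 ^ n)%N%:Z :> int by rewrite sumr_const cardK natz.
have total : \sum_b (fiber_bound b)%:R = (5 ^ n)%N%:Z.
  rewrite -cardK -sum_card_fiber -natz natr_sum.
  by apply: eq_bigr => b _; rewrite card_fiber.
have H0 : (w 0)%:Z + (w 1)%:Z + (w 2)%:Z = (5 ^ n)%N%:Z.
  rewrite !comega_sum -!big_split /= -card_sum; apply: eq_bigr => b _.
  by have := fiber_bound_le2 b; case: fiber_bound => [|[|[|]]].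
have H1 : (w 1)%:Z + 2 * (w 2)%:Z = (5 ^ n)%N%:Z.
  rewrite !comega_sum mulr_sumr -!big_split /= -total; apply: eq_bigr => b _.
  by have := fiber_bound_le2 b; case: fiber_bound => [|[|[|]]].
by move: H0 H1; move: (w 0) (w 1) (w 2) (5 ^ n)%N => a b c d; clear; lia.
Qed.

End Fibers.

(** * The spectrum *)

Section Spectrum.
Variables (K : finFieldType) (n : nat).
Hypothesis cardK : #|K| = (5 ^ n)%N.
Local Notation chi := (@quadchar K).
Local Notation F := (fun x : K => x ^+ ((5 ^ n - 3) %/ 2)).
Local Notation w := (comega (-1) F).
Let two0 := two_neq0 (card_quarter cardK).

Lemma power_map_inj : injective F.
Proof.
(* [F] is an involution, because [F x] has the same character as [x]. *)
have FF : cancel F F.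
  move=> x; rewrite [LHS](power_mapE cardK) (power_mapE cardK).
  have [->|x0] := eqVneq x 0; first by rewrite invr0 mulr0 quadchar0 mul0r.
  rewrite (quadcharM (card_quarter cardK)) (quadcharV (card_quarter cardK)).
  have [c1|c0] := quadchar_signr cardK x; last first.
    by move/eqP: c0; rewrite quadchar_eq0 (negPf x0).
  rewrite c1 mul1r invf_div mulrC -mulrA mulVf ?mulr1 //.
  by rewrite -quadchar_eq0 c1.
exact: can_inj FF.
Qed.

Lemma cdelta0_le1 b : (cdelta (-1)%R F 0%R b <= 1)%N.
Proof.
have FI := power_map_inj; apply/card_le1_eqP => x y; rewrite !inE => /eqP <-.
rewrite !addr0 => /eqP E; apply: FI; apply: (mulfI two0).
by move: E; move: (_ %/ _)%N => d /= E; transitivity (y ^+ d - -1 * y ^+ d);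
  [ring | rewrite E; ring].
Qed.

(** Since [F] is multiplicative, the substitution [x = a * y] reduces every nonzero [a] to 1. *)
Lemma cdelta_scale a b : a != 0 ->
  cdelta (-1) F a b = #|fiber n (F a^-1 * b)|.
Proof.
move=> a0; rewrite /cdelta -(card_imset _ (mulfI (invr_neq0 a0))).
apply: eq_card => y; rewrite [RHS]inE.
have Fa : F a^-1 * F a = 1 by rewrite -exprMn mulVf // expr1n.
have -> : (F (y + 1) - -1 * F y == F a^-1 * b)
    = (F (a * y + a) - -1 * F (a * y) == b).
  have -> : a * y + a = a * (y + 1) by ring.
  rewrite !exprMn; apply/eqP/eqP => [E|<-].
    have -> : F a * F (y + 1) - -1 * (F a * F y) = F a * (F (y + 1) - -1 * F y) by ring.
    by rewrite E mulrA [F a * _]mulrC Fa mul1r.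
  transitivity (F a^-1 * F a * (F (y + 1) - -1 * F y)); last by ring.
  by rewrite Fa mul1r.
apply/imsetP/idP => [[x]|E].
  by rewrite inE => E ->; rewrite mulVKf.
by exists (a * y); rewrite ?inE // mulKf.
Qed.

Lemma cuniformity_le2 : (cuniformity (-1)%R F <= 2)%N.
Proof.
apply/bigmax_leqP => -[a b] _ /=; have [->|a0] := eqVneq a 0.
  exact: leq_trans (cdelta0_le1 b) _.
by rewrite cdelta_scale // (card_fiber cardK) fiber_bound_le2.
Qed.

Lemma cdelta_le_cuniformity b : (cdelta (-1)%R F 1%R b <= cuniformity (-1)%R F)%N.
Proof.
pose P (p : K * K) := (-1 == 1 :> K) ==> (p.1 != 0).
apply: (@leq_bigmax_cond _ P (fun p => cdelta (-1) F p.1 p.2) (1, b)).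
by rewrite /P oner_eq0 implybT.
Qed.

Lemma comega1_gt0 : (0 < w 1)%N.
Proof.
apply/card_gt0P; exists 0; rewrite inE cdelta_fiber (card_fiber cardK).
rewrite /fiber_bound /fiber_sames_bound eqxx quadchar0.
by rewrite [0 == 1 :> K]eq_sym [0 == -1 :> K]eq_sym oppr_eq0 oner_eq0.
Qed.

(** If the count were 0, then [Gamma K] would be at least [3 * 5 ^ n - 13], too large for its square
    to be at most [4 * 5 ^ n] once [5 ^ n] is at least 25. *)
Lemma comega2_gt0 : (1 < n)%N -> (0 < w 2)%N.
Proof.
move=> n1; rewrite lt0n; apply/eqP => w0.
have := comega2E cardK; rewrite w0 mulr0 => /esym/eqP; rewrite subr_eq0 => /eqP GE.
have [b] := Gamma_sum_squares cardK; rewrite -GE.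
have : 5 * 5 <= 5 ^+ n :> int by rewrite -expr2 Num.Theory.ler_eXn2l.
have : chi 2 = 1 \/ chi 2 = -1 by exact: quadchar_sign.
by move: (5 ^+ n) (chi 2) => q e; clear; nia.
Qed.

Lemma cuniformity2 : (1 < n)%N -> cuniformity (-1) F = 2%N.
Proof.
move=> n1; apply/eqP; rewrite eqn_leq cuniformity_le2 /=.
have /card_gt0P[b] := comega2_gt0 n1; rewrite inE => /eqP bE.
by have := cdelta_le_cuniformity b; rewrite bE.
Qed.

Lemma comega_rat (m : int) : 8 * (w 2)%:Z = 3 * 5 ^+ n - m - Gamma K ->
  let G : rat := (Gamma K)%:~R in
  [/\ (w 0)%:R = - (1 / 8) * G + (3 * 5 ^+ n - m%:~R) / 8,
      (w 1)%:R = 1 / 4 * G + (5 ^+ n + m%:~R) / 4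
    & (w 2)%:R = - (1 / 8) * G + (3 * 5 ^+ n - m%:~R) / 8].
Proof.
move=> E G; have [w02 tot] := comega02E cardK; rewrite w02.
have {E}E : 8 * (w 2)%:R = 3 * 5 ^+ n - m%:~R - G :> rat.
  have := congr1 (fun z : int => z%:~R : rat) E.
  by rewrite !rmorphB !rmorphM rmorphXn /=.
have {}tot : (w 2)%:R + (w 1)%:R + (w 2)%:R = 5 ^+ n :> rat.
  by rewrite -{1}w02 -!natrD tot natrX.
by split; lra.
Qed.

End Spectrum.

Theorem theorem16 (K : finFieldType) (n : nat)
    (n_gt0 : (0 < n)%N) (cardK : #|K| = (5 ^ n)%N) :
  let F := fun x : K => x ^+ ((5 ^ n - 3) %/ 2) in
  let w := comega (-1) F in
  let G : rat := (Gamma K)%:~R in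
  [/\ (1 < n)%N ->
        APcN (-1) F /\ cspectrum (-1) F = seq_mset [:: w 0%N; w 1%N; w 2%N],
      n = 1%N -> cspectrum (-1) F = seq_mset [:: w 1%N],
      ~~ odd n ->
        [/\ (w 0%N)%:R = - (1 / 8) * G + (3 * 5 ^+ n - 5) / 8,
            (w 1%N)%:R = 1 / 4 * G + (5 ^+ n + 5) / 4
          & (w 2%N)%:R = - (1 / 8) * G + (3 * 5 ^+ n - 5) / 8],
      odd n ->
        [/\ (w 0%N)%:R = - (1 / 8) * G + (3 * 5 ^+ n - 13) / 8,
            (w 1%N)%:R = 1 / 4 * G + (5 ^+ n + 13) / 4
          & (w 2%N)%:R = - (1 / 8) * G + (3 * 5 ^+ n - 13) / 8]
    & Gamma K = (-1) ^+ n.+1 *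
        \sum_(0 <= k < (n %/ 2).+1) (-1) ^+ k * ('C(n, 2 * k) * 2 ^ (2 * k + 1))%:R].
Proof.
move=> F w G.
have w02 : w 0%N = w 2%N by have [] := comega02E cardK.
have w1 : (0 < w 1%N)%N := comega1_gt0 cardK.
split.
- move=> n1; have w2 : (0 < w 2%N)%N := comega2_gt0 cardK n1.
  have unif : cuniformity (-1) F = 2%N := cuniformity2 cardK n1.
  by split=> //; rewrite /cspectrum unif /= -/(w 0%N) -/(w 1%N) -/(w 2%N) w02 w1 w2.
- move=> n1.
  (* For [n = 1] the exponent is 1 and the map is [2 * x + a], hence injective; the zero counts then
     drop out of the spectrum. *)
  have le1 a b : (cdelta (-1)%R F a b <= 1)%N.
    apply/card_le1_eqP => x y; rewrite !inE /F n1 /= !expr1 => /eqP <- /eqP E.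
    apply: (mulfI (two_neq0 (card_quarter cardK))); apply: (addrI a).
    by transitivity (y + a - -1 * y); [ring | rewrite E; ring].
  have unif : cuniformity (-1) F = 1%N.
    apply/eqP; rewrite eqn_leq; apply/andP; split.
      by apply/bigmax_leqP => -[a b] _; apply: le1.
    have /card_gt0P[b] := w1; rewrite inE => /eqP bE.
    by have := cdelta_le_cuniformity n b; rewrite bE.
  have w2 : w 2%N = 0%N.
    apply/eqP; rewrite cards_eq0; apply/eqP/setP => b; rewrite !inE.
    by apply/negP => /eqP E; have := le1 1 b; rewrite E.
  by rewrite /cspectrum unif /= -/(w 0%N) -/(w 1%N) w02 w2 w1.
- move=> nodd; apply: (comega_rat cardK (m := 5)).
  by rewrite (comega2E cardK) (quadchar2 cardK) (negPf nodd); ring.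
- move=> nodd; apply: (comega_rat cardK (m := 13)).
  by rewrite (comega2E cardK) (quadchar2 cardK) nodd; ring.
exact: Gamma_closed_form cardK.
Qed.
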